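(* For any integer $n\ge 1$ and any integer $m\ge 0$, $$\binom{m+n}{m}\sum_{k=1+m}^{n+m}\frac{1}{k}=\sum_{k=1}^{n}\frac{(-1)^{k+1}}{k}\binom{m+n}{m+k}.$$ *)

(* Defs.v *)
From mathcomp Require Export all_boot all_order all_algebra.

(* Main.v *)
(** Write [N = m + n] and [H] for the harmonic numbers. Both sides, viewed as
    functions [f(N, m)], satisfy Pascal's rule
    [f(N+1, m+1) = f(N, m+1) + f(N, m)]; for the left-hand side this is the
    absorption identity [C(N+1, m+1) / (N+1) = C(N, m) / (m+1)]. On the boundary
    [m = 0] absorption turns the increment of the right-hand side in [N] into
    [1/(N+1)] times an alternating sum of binomials, which equals [1]. *)
Require Import Defs.
From mathcomp Require Import all_boot all_order all_algebra.
From mathcomp Require Import ring.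
Import GRing.Theory.
Local Open Scope ring_scope.

Definition harmonic (F : fieldType) (n : nat) : F := \sum_(k < n) k.+1%:R^-1.

(** By Pascal's rule the sum telescopes: each term is the drop of [(-1) ^+ k * 'C(n, k)] from [k] to
    [k.+1]. *)
Lemma alternating_bin_sum (R : comNzRingType) (n p : nat) :
  \sum_(k < p) (-1) ^+ k * 'C(n.+1, k.+1)%:R = 1 - (-1) ^+ p * 'C(n, p)%:R :> R.
Proof.
elim: p => [|p IHp]; first by rewrite big_ord0 bin0; ring.
by rewrite big_ord_recr /= IHp binS natrD exprS; ring.
Qed.

Lemma bin_absorb (n k : nat) :
  k.+1%:R^-1 * 'C(n, k)%:R = n.+1%:R^-1 * 'C(n.+1, k.+1)%:R :> rat.
Proof.
have nz i : i.+1%:R != 0 :> rat by rewrite Num.Theory.pnatr_eq0.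
apply: (mulfI (nz k)); apply: (mulfI (nz n)).
by rewrite mulVKf // -natrM mul_bin_diag natrM mulrCA mulVKf.
Qed.

(* Terms with [k >= N - m] vanish, so any bound [p >= N - m] works; keeping [p]
   fixed makes Pascal's rule apply termwise. *)
Lemma bin_harmonic_sum (p N m : nat) : (N <= m + p)%N ->
  'C(N, m)%:R * (harmonic rat N - harmonic rat m)
  = \sum_(k < p) (-1) ^+ k / k.+1%:R * 'C(N, m + k.+1)%:R.
Proof.
elim: N m => [|N IHN] [|m] le_N.
- by rewrite subrr mulr0 big1 // => k _; rewrite bin0n mulr0.
- by rewrite bin0n mul0r big1 // => k _; rewrite bin0n mulr0.
- have := IHN 0%N (ltnW le_N); rewrite !bin0 !mul1r => IH0.
  under eq_bigr => k _ do rewrite add0n binS natrD mulrDr.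
  rewrite big_split /= -IH0.
  under [X in _ = _ + X]eq_bigr => k _ do rewrite -mulrA bin_absorb mulrCA.
  (* [le_N] amounts to [N < p], so the remainder ['C(N, p)] vanishes. *)
  rewrite -mulr_sumr alternating_bin_sum (bin_small le_N) mulr0 subr0 mulr1.
  by rewrite /harmonic big_ord_recr /=; ring.
- under eq_bigr => k _ do rewrite addSn binS natrD mulrDr -addSn.
  rewrite big_split /= -!IHN //; last exact: ltnW.
  rewrite /harmonic !big_ord_recr /= -!/(harmonic rat _).
  have := bin_absorb N m; rewrite binS natrD => absorb.
  (* Isolates the [N.+1%:R^-1] term: by absorption it becomes ['C(N, m) / m.+1], which turns
     [harmonic rat m.+1] into [harmonic rat m] in the ['C(N, m)] part. *)
  transitivity (('C(N, m.+1)%:R + 'C(N, m)%:R)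
      * (harmonic rat N - (harmonic rat m + m.+1%:R^-1))
    + N.+1%:R^-1 * ('C(N, m.+1)%:R + 'C(N, m)%:R)); first by ring.
  by rewrite -absorb; ring.
Qed.

Theorem theorem4p1 (n m : nat) (hn : (1 <= n)%N) :
  'C(m + n, m)%:R * (\sum_(1 + m <= k < (n + m).+1) 1 / k%:R)
  = \sum_(1 <= k < n.+1) (-1) ^+ (k + 1) / k%:R * 'C(m + n, m + k)%:R :> rat.
Proof.
have -> : \sum_(1 + m <= k < (n + m).+1) 1 / k%:R
    = harmonic rat (m + n) - harmonic rat m.
  rewrite /harmonic -!(big_mkord xpredT (fun k => k.+1%:R^-1)).
  rewrite (big_cat_nat (leq0n m) (leq_addr n m)) /= addrAC subrr add0r.
  by rewrite add1n big_add1 /= addnC; apply: eq_bigr => k _; rewrite mul1r.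
rewrite (bin_harmonic_sum n) // big_add1 /= big_mkord.
(* Shifting the index makes the exponent [k + 2]; the two extra signs cancel. *)
by apply: eq_bigr => k _; rewrite addn1 !exprS mulN1r mulN1r opprK.
Qed.
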